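(* $$\pi^3 = 720\, S_3(\pi) - 900\, S_3(2\pi) + 180\, S_3(4\pi).$$
   Context: For $x > 0$, $S_3(x) = \sum_{n=1}^{\infty} \frac{1}{n^3 (e^{xn} - 1)}$. *)

(* Defs.v *)
From Stdlib Require Import Reals.
From Coquelicot Require Import Coquelicot.
Open Scope R_scope.

(** The series runs over [n >= 1]; [Series] starts at index [0], hence the
    shift [n |-> S n]. It converges for every [x > 0], so that there [Series]
    is its sum. *)
Definition S3 (x : R) : R :=
  Series (fun n : nat => 1 / (INR (S n) ^ 3 * (exp (x * INR (S n)) - 1))).

(* Main.v *)
Require Import Defs.
From Stdlib Require Import Reals Lra Lia.
From Coquelicot Require Import Coquelicot.
Open Scope R_scope.

(** For [a > 0], inserting the partial fraction expansion of
    [1 / (e^(2 pi a n) - 1) = (coth (pi a n) - 1) / 2] gives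
    [S3 (2 pi a) = (a / pi) T(a) - zeta(3) / 2 + zeta(4) / (2 pi a)], where
    [T(a) = sum_n sum_m 1 / (n^2 (m^2 + a^2 n^2))], and exchanging the two sums
    shows [T(a) + T(1/a) = zeta(2)^2]. In the combination of the theorem, [zeta(3)]
    cancels, and the cases [a = 1] and [a = 2] of this reflection formula suffice.

    The expansion of [coth], [zeta(2)] and [zeta(4)] all come from the moments
    [W_n(f) = int_0^(pi/2) cos^(2n) t f(t) dt]. Two integrations by parts give
    [W_n(f'') + 4 n^2 W_n(f) = 2n (2n - 1) W_(n-1)(f)] when [f'(0) = 0], which for
    [f = 1, t^2, t^4, cosh (2yt), t sinh (2yt)] yields telescoping recurrences for
    quotients of moments (Matsuoka's proof of Euler's formula); the quotients tend
    to [0] because [t cos t <= sin t]. *)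

(** * Telescoping series, and a comparison of t cos t with sin t *)

Lemma is_series_telescope (u v : nat -> R) :
  (forall n, u n = v n - v (S n)) -> is_lim_seq v 0 -> is_series u (v 0%nat).
Proof.
intros Huv Hv.
change (is_lim_seq (sum_n u) (v 0%nat)).
apply (is_lim_seq_ext (fun n => v 0%nat - v (S n))).
  intros n; induction n as [|n IH].
    now rewrite sum_O, Huv.
  rewrite sum_Sn, <- IH, Huv; unfold plus; simpl; ring.
replace (Finite (v 0%nat)) with (Finite (v 0%nat - 0)) by (f_equal; ring).
apply is_lim_seq_minus'; [apply is_lim_seq_const|].
now apply is_lim_seq_incr_1 in Hv.
Qed.

(** The function sin x - x cos x vanishes at 0 and has derivative x sin x, which is nonnegative on
    [0, pi]. *)
Lemma mul_cos_le_sin (t : R) : 0 <= t <= PI -> t * cos t <= sin t.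
Proof.
intros [Ht0 Ht].
destruct (MVT_gen (fun x => sin x - x * cos x) 0 t (fun x => x * sin x))
  as [c [Hc Heq]].
- intros x _; auto_derive; [trivial|ring].
- intros x _; apply continuity_pt_filterlim.
  apply (ex_derive_continuous (fun x => sin x - x * cos x)); auto_derive; trivial.
- rewrite Rmin_left, Rmax_right in Hc by lra.
  rewrite sin_0 in Heq.
  assert (0 <= sin c) by (apply sin_ge_0; lra).
  assert (0 <= c * sin c * (t - 0)) by (apply Rmult_le_pos; [apply Rmult_le_pos|]; lra).
  lra.
Qed.

(** * Moments against even powers of the cosine *)

Definition cos_moment (n : nat) (f : R -> R) : R :=
  RInt (fun t => cos t ^ (2 * n) * f t) 0 (PI / 2).

Lemma continuous_cos_pow_mult (k : nat) (f : R -> R) (t : R) :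
  continuous f t -> continuous (fun t => cos t ^ k * f t) t.
Proof.
intros Hf; apply (continuous_mult (fun t => cos t ^ k) f); [|exact Hf].
apply (ex_derive_continuous (fun t => cos t ^ k)); auto_derive; trivial.
Qed.

Lemma ex_RInt_cos_moment (n : nat) (f : R -> R) :
  (forall t, continuous f t) ->
  ex_RInt (fun t => cos t ^ (2 * n) * f t) 0 (PI / 2).
Proof.
intros Hf; apply (ex_RInt_continuous (V := R_CompleteNormedModule)); intros t _.
now apply continuous_cos_pow_mult.
Qed.

Lemma cos_moment_scal (n : nat) (c : R) (f : R -> R) :
  (forall t, continuous f t) ->
  cos_moment n (fun t => c * f t) = c * cos_moment n f.
Proof.
intros Hf; unfold cos_moment.
rewrite <- (RInt_scal (fun t => cos t ^ (2 * n) * f t)) by now apply ex_RInt_cos_moment.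
apply RInt_ext; intros t _; unfold scal; simpl; unfold mult; simpl; ring.
Qed.

Lemma cos_moment_plus (n : nat) (f g : R -> R) :
  (forall t, continuous f t) -> (forall t, continuous g t) ->
  cos_moment n (fun t => f t + g t) = cos_moment n f + cos_moment n g.
Proof.
intros Hf Hg; unfold cos_moment.
rewrite <- (RInt_plus (fun t => cos t ^ (2 * n) * f t) (fun t => cos t ^ (2 * n) * g t))
  by now apply ex_RInt_cos_moment.
apply RInt_ext; intros t _; unfold plus; simpl; ring.
Qed.

Lemma cos_moment_nonneg (n : nat) (f : R -> R) :
  (forall t, continuous f t) -> (forall t, 0 <= t -> 0 <= f t) ->
  0 <= cos_moment n f.
Proof.
intros Hf Hf0; apply RInt_ge_0.
- generalize PI_RGT_0; lra.
- now apply ex_RInt_cos_moment.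
- intros t Ht; apply Rmult_le_pos; [|apply Hf0; lra].
  rewrite pow_mult; apply pow_le, pow2_ge_0.
Qed.

Lemma cos_moment_parts (n : nat) (f f' f'' : R -> R) :
  (forall t, is_derive f t (f' t)) -> (forall t, is_derive f' t (f'' t)) ->
  (forall t, continuous f'' t) -> f' 0 = 0 ->
  cos_moment (S n) f'' + 4 * INR (S n) ^ 2 * cos_moment (S n) f
  = 2 * INR (S n) * (2 * INR n + 1) * cos_moment n f.
Proof.
intros Hf Hf' Hc H0.
assert (Cf : forall t, continuous f t).
  intros t; apply (ex_derive_continuous f); eexists; apply Hf.
assert (Cs : forall (c : R) t, continuous (fun t => c * f t) t).
  intros c t; apply (continuous_mult (fun _ => c) f); [apply continuous_const|apply Cf].
(* Both integrations by parts are packed into the single antiderivative [F]. It vanishes at pi/2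
   because of the powers of cos, and at 0 because f'(0) = 0 and sin 0 = 0. Its derivative becomes
   [G] once sin^2 is replaced by 1 - cos^2. *)
set (F := fun t => cos t ^ (2 * S n) * f' t
                   + 2 * INR (S n) * (cos t ^ (2 * n + 1) * sin t * f t)).
set (G := fun t => (cos t ^ (2 * S n) * f'' t
                    + cos t ^ (2 * S n) * (4 * INR (S n) ^ 2 * f t))
                   + cos t ^ (2 * n) * (- (2 * INR (S n) * (2 * INR n + 1)) * f t)).
assert (HI : is_RInt G 0 (PI / 2) (minus (F (PI / 2)) (F 0))).
  apply (is_RInt_derive (V := R_CompleteNormedModule) F).
  - intros t _; unfold F, G.
    remember (2 * S n)%nat as a eqn:Ha; remember (2 * n + 1)%nat as b eqn:Hb.
    remember (INR (S n)) as x eqn:Hx.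
    auto_derive.
      repeat split; eexists; [apply Hf'|apply Hf].
    replace (Derive (fun x : R => f x) t) with (f' t)
      by (symmetry; apply is_derive_unique, Hf).
    replace (Derive (fun x : R => f' x) t) with (f'' t)
      by (symmetry; apply is_derive_unique, Hf').
    replace (INR a) with (2 * x) by (subst; rewrite mult_INR; simpl; ring).
    replace (INR b) with (2 * INR n + 1)
      by (subst; rewrite plus_INR, mult_INR; simpl; ring).
    rewrite S_INR in Hx.
    replace (Init.Nat.pred a) with (2 * n + 1)%nat by lia.
    replace (Init.Nat.pred b) with (2 * n)%nat by lia.
    replace a with (2 * n + 2)%nat by lia.
    rewrite Hb, Hx, !(pow_add _ (2 * n)).
    generalize (sin2_cos2 t); unfold Rsqr; intros Hsc.
    (* The two expressions for the derivative differ by a multiple of 1 - (sin^2 + cos^2). *)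
    apply Rminus_diag_uniq.
    transitivity (2 * (INR n + 1) * (2 * INR n + 1) * cos t ^ (2 * n) * f t
      * (1 - (sin t * sin t + cos t * cos t))); [ring|].
    rewrite Hsc; ring.
  - intros t _; unfold G.
    apply @continuous_plus; [apply @continuous_plus|]; apply continuous_cos_pow_mult; auto.
assert (HF : minus (F (PI / 2)) (F 0) = 0).
  unfold minus, plus, opp, F; simpl.
  rewrite cos_PI2, sin_0, H0, !Nat.add_0_r, !Nat.add_succ_r, !pow_ne_zero by lia.
  ring.
rewrite HF in HI; apply (is_RInt_unique (V := R_CompleteNormedModule)) in HI; unfold G in HI.
rewrite (RInt_plus (fun t => cos t ^ (2 * S n) * f'' t
                    + cos t ^ (2 * S n) * (4 * INR (S n) ^ 2 * f t))) in HI.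
- rewrite (RInt_plus (fun t => cos t ^ (2 * S n) * f'' t)) in HI
    by now apply ex_RInt_cos_moment.
  generalize (cos_moment_scal (S n) (4 * INR (S n) ^ 2) f Cf)
    (cos_moment_scal n (- (2 * INR (S n) * (2 * INR n + 1))) f Cf).
  unfold cos_moment, plus in *; simpl in HI |- *; lra.
- apply @ex_RInt_plus; now apply ex_RInt_cos_moment.
- now apply ex_RInt_cos_moment.
Qed.

(** Integrating the derivative of cos^(2n+2) g, whose boundary values vanish, turns the moment of g'
    into 2(n+1) times the integral of cos^(2n+1) sin g; then sin t >= t cos t. This is the source of
    the 1/n decay of all the quotients of moments below. *)
Lemma cos_moment_decay (n : nat) (g g' : R -> R) :
  (forall t, is_derive g t (g' t)) -> (forall t, continuous g' t) ->
  g 0 = 0 -> (forall t, 0 <= t -> 0 <= g t) ->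
  2 * INR (S n) * cos_moment (S n) (fun t => t * g t) <= cos_moment (S n) g'.
Proof.
intros Hg Hc H0 Hpos.
assert (Cg : forall t, continuous g t).
  intros t; apply (ex_derive_continuous g); eexists; apply Hg.
assert (Ct : forall t, continuous (fun t => t * g t) t).
  intros t; apply (continuous_mult (fun t => t) g); [apply continuous_id|apply Cg].
rewrite <- cos_moment_scal by exact Ct.
assert (Cs : forall t, continuous
   (fun t => cos t ^ (2 * n + 1) * (2 * INR (S n) * (sin t * g t))) t).
  intros t; apply continuous_cos_pow_mult.
  apply (continuous_mult (fun _ => 2 * INR (S n)) (fun t => sin t * g t));
    [apply continuous_const|].
  apply (continuous_mult sin g); [|apply Cg].
  apply (ex_derive_continuous sin); auto_derive; trivial.
set (F := fun t => cos t ^ (2 * S n) * g t).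
assert (HI : is_RInt (fun t => cos t ^ (2 * S n) * g' t
     - cos t ^ (2 * n + 1) * (2 * INR (S n) * (sin t * g t))) 0 (PI / 2)
     (minus (F (PI / 2)) (F 0))).
  apply (is_RInt_derive (V := R_CompleteNormedModule) F).
  - intros t _; unfold F.
    remember (2 * S n)%nat as a eqn:Ha.
    auto_derive.
      repeat split; eexists; apply Hg.
    replace (Derive (fun x : R => g x) t) with (g' t)
      by (symmetry; apply is_derive_unique, Hg).
    replace (INR a) with (2 * INR (S n)) by (subst; rewrite mult_INR; simpl; ring).
    replace (Init.Nat.pred a) with (2 * n + 1)%nat by lia.
    ring.
  - intros t _; apply @continuous_minus; [|apply Cs].
    now apply continuous_cos_pow_mult.
assert (HF : minus (F (PI / 2)) (F 0) = 0).
  unfold minus, plus, opp, F; simpl.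
  rewrite cos_PI2, H0; ring.
rewrite HF in HI; apply (is_RInt_unique (V := R_CompleteNormedModule)) in HI.
rewrite (RInt_minus (fun t => cos t ^ (2 * S n) * g' t)) in HI.
- fold (cos_moment (S n) g') in HI.
  apply Rle_trans with (RInt (fun t => cos t ^ (2 * n + 1) * (2 * INR (S n) * (sin t * g t)))
                          0 (PI / 2)); [|unfold minus, plus, opp in HI; simpl in HI |- *; lra].
  generalize PI_RGT_0; intros HPI.
  apply RInt_le; [lra| | |].
  + apply ex_RInt_cos_moment; intros t.
    apply (continuous_mult (fun _ => 2 * INR (S n))); [apply continuous_const|apply Ct].
  + apply (ex_RInt_continuous (V := R_CompleteNormedModule)); intros t _; apply Cs.
  + intros t Ht.
    (* One factor cos t is split off, to be paired with t in t cos t <= sin t. *)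
    replace (2 * S n)%nat with (2 * n + 1 + 1)%nat by lia.
    rewrite pow_add, pow_1, Rmult_assoc.
    apply Rmult_le_compat_l; [apply pow_le, cos_ge_0; lra|].
    replace (cos t * (2 * INR (S n) * (t * g t)))
      with (2 * INR (S n) * (t * cos t * g t)) by ring.
    apply Rmult_le_compat_l; [generalize (pos_INR (S n)); lra|].
    apply Rmult_le_compat_r; [apply Hpos; lra|].
    apply mul_cos_le_sin; lra.
- now apply ex_RInt_cos_moment.
- apply (ex_RInt_continuous (V := R_CompleteNormedModule)); intros t _; apply Cs.
Qed.

Lemma cos_moment_pos (n : nat) (f : R -> R) :
  (forall t, continuous f t) -> (forall t, 0 < f t) -> 0 < cos_moment n f.
Proof.
intros Hf Hf0; generalize PI_RGT_0; intros HPI; apply RInt_gt_0; [lra| |].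
- intros t Ht; apply Rmult_lt_0_compat; [|apply Hf0].
  apply pow_lt, cos_gt_0; lra.
- intros t _; now apply continuous_cos_pow_mult.
Qed.

Lemma cos_moment_0 (f F : R -> R) :
  (forall t, is_derive F t (f t)) -> (forall t, continuous f t) ->
  cos_moment 0 f = F (PI / 2) - F 0.
Proof.
intros HF Hf; unfold cos_moment.
apply (is_RInt_unique (V := R_CompleteNormedModule)).
apply (is_RInt_ext f).
  intros t _; simpl; ring.
apply (is_RInt_derive (V := R_CompleteNormedModule) F); intros t _; auto.
Qed.

Lemma is_lim_seq_div_INR_S (c : R) : is_lim_seq (fun n => c / INR (S n)) 0.
Proof.
apply (is_lim_seq_incr_1 (fun n => c / INR n)).
replace (Finite 0) with (Rbar_mult c (Rbar_inv p_infty)) by (simpl; f_equal; ring).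
apply is_lim_seq_mult'; [apply is_lim_seq_const|].
apply (is_lim_seq_inv INR p_infty); [apply is_lim_seq_INR|discriminate].
Qed.

(** * Moments of monomials, zeta(2) and zeta(4) *)

Lemma continuous_monomial (k : nat) (t : R) : continuous (fun t => t ^ k) t.
Proof.
apply (ex_derive_continuous (fun t => t ^ k)); auto_derive; trivial.
Qed.

Lemma cos_moment_1_pos (n : nat) : 0 < cos_moment n (fun _ => 1).
Proof.
apply cos_moment_pos; intros t; [apply continuous_const|lra].
Qed.

(** This is the recurrence of the Wallis integrals, the case f = 1 of the integration by parts. *)
Lemma cos_moment_1_step (n : nat) :
  4 * INR (S n) ^ 2 * cos_moment (S n) (fun _ => 1)
  = 2 * INR (S n) * (2 * INR n + 1) * cos_moment n (fun _ => 1).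
Proof.
assert (C : forall t : R, continuous (fun _ : R => 1) t)
  by (intros t; apply continuous_const).
rewrite <- (cos_moment_parts n (fun _ => 1) (fun _ => 0) (fun _ => 0 * 1)).
- rewrite cos_moment_scal by exact C; ring.
- intros t; auto_derive; [trivial|ring].
- intros t; auto_derive; [trivial|ring].
- intros t; apply continuous_const.
- reflexivity.
Qed.

Definition moment_ratio (k n : nat) : R :=
  cos_moment n (fun t => t ^ k) / cos_moment n (fun _ => 1).

Lemma cos_moment_parts_monomial (k n : nat) :
  INR (k + 2) * INR (k + 1) * cos_moment (S n) (fun t => t ^ k)
  + 4 * INR (S n) ^ 2 * cos_moment (S n) (fun t => t ^ (k + 2))
  = 2 * INR (S n) * (2 * INR n + 1) * cos_moment n (fun t => t ^ (k + 2)).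
Proof.
rewrite <- (cos_moment_parts n _ (fun t => INR (k + 2) * t ^ (k + 1))
              (fun t => INR (k + 2) * INR (k + 1) * t ^ k)).
- now rewrite cos_moment_scal by apply continuous_monomial.
- intros t; remember (k + 2)%nat as a; auto_derive; [trivial|].
  replace (Init.Nat.pred a) with (k + 1)%nat by lia; ring.
- intros t; remember (INR (k + 2)); remember (k + 1)%nat as a; auto_derive; [trivial|].
  replace (Init.Nat.pred a) with k by lia; ring.
- intros t; apply (continuous_mult (fun _ => INR (k + 2) * INR (k + 1)) (fun t => t ^ k));
    [apply continuous_const|apply continuous_monomial].
- rewrite pow_ne_zero by lia; ring.
Qed.

(** The recurrences for t^(k+2) and for 1 share the factor 2(n+1)(2n+1) at index n and 4(n+1)^2 at
    index n+1. Both cancel in the quotient, and only the contribution of the second derivative is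
    left. *)
Lemma moment_ratio_step (k n : nat) :
  moment_ratio (k + 2) n - moment_ratio (k + 2) (S n)
  = INR (k + 2) * INR (k + 1) / (4 * INR (S n) ^ 2) * moment_ratio k (S n).
Proof.
assert (H := cos_moment_parts_monomial k n).
assert (HI := cos_moment_1_step n).
assert (P := cos_moment_1_pos n); assert (P' := cos_moment_1_pos (S n)).
unfold moment_ratio.
set (I := cos_moment n (fun _ => 1)) in *; set (I' := cos_moment (S n) (fun _ => 1)) in *.
set (A := cos_moment n (fun t => t ^ (k + 2))) in *.
set (A' := cos_moment (S n) (fun t => t ^ (k + 2))) in *.
set (B := cos_moment (S n) (fun t => t ^ k)) in *.
assert (Hn : 0 < INR (S n)) by apply lt_0_INR, Nat.lt_0_succ.
assert (Hn0 := pos_INR n).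
(* The quotient is expanded by the common factor 2(n+1)(2n+1), so that the denominator can be moved
   to index n+1. *)
assert (HA : A / I = (2 * INR (S n) * (2 * INR n + 1) * A) / (4 * INR (S n) ^ 2 * I')).
  rewrite HI; field; repeat split; lra.
rewrite HA, <- H; field; repeat split; lra.
Qed.

(** The upper bound is [cos_moment_decay] for g = t^(k+1). *)
Lemma moment_ratio_bound (k n : nat) :
  0 <= moment_ratio (k + 2) (S n)
    <= INR (k + 1) / (2 * INR (S n)) * moment_ratio k (S n).
Proof.
assert (P := cos_moment_1_pos (S n)).
assert (Hn : 0 < INR (S n)) by apply lt_0_INR, Nat.lt_0_succ.
unfold moment_ratio; split.
- apply Rdiv_le_0_compat; [|exact P].
  apply cos_moment_nonneg; [apply continuous_monomial|].
  intros t Ht; now apply pow_le.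
- assert (H := cos_moment_decay n (fun t => t ^ (k + 1)) (fun t => INR (k + 1) * t ^ k)).
  rewrite cos_moment_scal in H by apply continuous_monomial.
  replace (k + 2)%nat with (S (k + 1)) by lia.
  change (cos_moment (S n) (fun t => t * t ^ (k + 1)))
    with (cos_moment (S n) (fun t => t ^ S (k + 1))) in H.
  unfold Rdiv; rewrite <- Rmult_assoc.
  apply Rmult_le_compat_r; [now apply Rlt_le, Rinv_0_lt_compat|].
  apply (Rmult_le_reg_l (2 * INR (S n))); [lra|].
  replace (2 * INR (S n) * (INR (k + 1) * / (2 * INR (S n)) * cos_moment (S n) (fun t => t ^ k)))
    with (INR (k + 1) * cos_moment (S n) (fun t => t ^ k)) by (field; lra).
  apply H.
  + intros t; remember (k + 1)%nat as a; auto_derive; [trivial|].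
    replace (Init.Nat.pred a) with k by lia; ring.
  + intros t; apply (continuous_mult (fun _ => INR (k + 1)) (fun t => t ^ k));
      [apply continuous_const|apply continuous_monomial].
  + apply pow_ne_zero; lia.
  + intros t Ht; now apply pow_le.
Qed.

Lemma moment_ratio_0 (n : nat) : moment_ratio 0 n = 1.
Proof.
unfold moment_ratio; simpl; field; generalize (cos_moment_1_pos n); lra.
Qed.

Lemma moment_ratio_at_0 (k : nat) : moment_ratio k 0 = (PI / 2) ^ k / INR (k + 1).
Proof.
assert (Hk : 0 < INR (k + 1)) by (apply lt_0_INR; lia).
assert (HPI := PI_RGT_0).
unfold moment_ratio.
rewrite (cos_moment_0 (fun t => t ^ k) (fun t => t ^ (k + 1) / INR (k + 1))).
- rewrite (cos_moment_0 (fun _ => 1) (fun t => t)).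
  + rewrite !pow_add; simpl; field; lra.
  + intros t; auto_derive; [trivial|ring].
  + intros t; apply continuous_const.
- intros t; remember (INR (k + 1)) as x eqn:Hx; remember (k + 1)%nat as a; auto_derive; [trivial|].
  replace (Init.Nat.pred a) with k by lia; rewrite <- Hx; field; lra.
- apply continuous_monomial.
Qed.

Lemma moment_ratio_2_bound (n : nat) : 0 <= moment_ratio 2 (S n) <= / 2 / INR (S n).
Proof.
assert (H := moment_ratio_bound 0 n); rewrite moment_ratio_0 in H; simpl (0 + _)%nat in H.
assert (Hn : 0 < INR (S n)) by apply lt_0_INR, Nat.lt_0_succ.
replace (/ 2 / INR (S n)) with (INR 1 / (2 * INR (S n)) * 1) by (simpl (INR 1); field; lra).
exact H.
Qed.

Lemma is_lim_seq_moment_ratio_2 : is_lim_seq (moment_ratio 2) 0.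
Proof.
apply is_lim_seq_incr_1.
apply (is_lim_seq_le_le (fun _ => 0) _ (fun n => / 2 / INR (S n))).
- apply moment_ratio_2_bound.
- apply is_lim_seq_const.
- apply is_lim_seq_div_INR_S.
Qed.

Lemma is_lim_seq_moment_ratio_4 : is_lim_seq (moment_ratio 4) 0.
Proof.
apply is_lim_seq_incr_1.
apply (is_lim_seq_le_le (fun _ => 0) _ (fun n => (3 / 4) / INR (S n))).
(* With N = n+1, the two bounds multiply to 3/(2N) * 1/(2N), which is at most (3/4)/N since N >=
   1. *)
- intros n; assert (H := moment_ratio_bound 2 n); assert (H2 := moment_ratio_2_bound n).
  simpl (2 + _)%nat in H.
  split; [apply H|]; eapply Rle_trans; [apply H|].
  assert (Hn : 1 <= INR (S n)) by (rewrite S_INR; generalize (pos_INR n); lra).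
  assert (Hi : 0 < / INR (S n) <= 1).
    split; [apply Rinv_0_lt_compat; lra|].
    rewrite <- Rinv_1; apply Rinv_le_contravar; lra.
  unfold Rdiv in *; rewrite Rinv_mult; replace (INR 3) with 3 by (simpl; ring).
  nra.
- apply is_lim_seq_const.
- apply is_lim_seq_div_INR_S.
Qed.

Lemma is_series_zeta2 : is_series (fun n => 1 / INR (S n) ^ 2) (PI ^ 2 / 6).
Proof.
(* For k = 0 each step decreases [moment_ratio 2] by 1 / (2 (n+1)^2), whence the factor 2; the
   starting value is pi^2/12. *)
replace (PI ^ 2 / 6) with (2 * moment_ratio 2 0)
  by (rewrite moment_ratio_at_0; simpl; field).
apply (is_series_telescope _ (fun n => 2 * moment_ratio 2 n)).
- intros n; assert (H := moment_ratio_step 0 n); rewrite moment_ratio_0 in H; simpl (0 + _)%nat in H.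
  rewrite <- Rmult_minus_distr_l, H; simpl (INR 2); simpl (INR 1); field.
  apply not_0_INR; lia.
- replace (Finite 0) with (Finite (2 * 0)) by (f_equal; ring).
  apply is_lim_seq_mult'; [apply is_lim_seq_const|apply is_lim_seq_moment_ratio_2].
Qed.

(* The step relations give [3 (r_n^2 - r_{n+1}^2) - (s_n - s_{n+1}) = (3/4) / (n+1)^4]
   for [r = moment_ratio 2] and [s = moment_ratio 4]. *)
Lemma is_series_zeta4 : is_series (fun n => 1 / INR (S n) ^ 4) (PI ^ 4 / 90).
Proof.
(* The factor 4/3 inverts the 3/4 of the step relation, and the starting values are r_0 = pi^2/12
   and s_0 = pi^4/80. The weight 3 makes the cross term 3 r_{n+1} / (n+1)^2 of the squares cancel
   against s_n - s_{n+1}. *)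
replace (PI ^ 4 / 90) with (4 / 3 * (3 * (moment_ratio 2 0 * moment_ratio 2 0) - moment_ratio 4 0))
  by (rewrite !moment_ratio_at_0; simpl; field).
apply (is_series_telescope _
  (fun n => 4 / 3 * (3 * (moment_ratio 2 n * moment_ratio 2 n) - moment_ratio 4 n))).
- intros n; assert (H := moment_ratio_step 0 n); rewrite moment_ratio_0 in H; simpl (0 + _)%nat in H.
  assert (H4 := moment_ratio_step 2 n); simpl (2 + _)%nat in H4.
  replace (moment_ratio 4 n) with (moment_ratio 4 (S n) + (moment_ratio 4 n - moment_ratio 4 (S n))) by ring.
  rewrite H4.
  replace (moment_ratio 2 n) with (moment_ratio 2 (S n) + (moment_ratio 2 n - moment_ratio 2 (S n))) by ring.
  rewrite H; replace (INR 4) with 4 by (simpl; ring); replace (INR 3) with 3 by (simpl; ring);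
    replace (INR 2) with 2 by (simpl; ring); replace (INR 1) with 1 by (simpl; ring); field.
  apply not_0_INR; lia.
- replace (Finite 0) with (Finite (4 / 3 * (3 * (0 * 0) - 0))) by (f_equal; ring).
  assert (L := is_lim_seq_moment_ratio_2).
  apply is_lim_seq_mult'; [apply is_lim_seq_const|].
  apply is_lim_seq_minus'; [|apply is_lim_seq_moment_ratio_4].
  apply is_lim_seq_mult'; [apply is_lim_seq_const|].
  now apply is_lim_seq_mult'.
Qed.

(** * The partial fraction expansion of coth *)

Lemma is_derive_sinh_scal (c t : R) :
  is_derive (fun t => sinh (c * t)) t (c * cosh (c * t)).
Proof. unfold sinh, cosh; auto_derive; [trivial|unfold Rdiv; ring]. Qed.

Lemma is_derive_cosh_scal (c t : R) :
  is_derive (fun t => cosh (c * t)) t (c * sinh (c * t)).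
Proof. unfold sinh, cosh; auto_derive; [trivial|unfold Rdiv; ring]. Qed.

Lemma cosh_pos (x : R) : 0 < cosh x.
Proof. unfold cosh; generalize (exp_pos x) (exp_pos (- x)); lra. Qed.

Lemma sinh_nonneg (x : R) : 0 <= x -> 0 <= sinh x.
Proof.
intros [Hx|<-]; [|rewrite sinh_0; lra].
rewrite <- sinh_0; apply Rlt_le, sinh_lt, Hx.
Qed.

(** With J_n and K_n the moments of cosh (2yt) and t sinh (2yt), the two recurrences have the same
    coefficients except for an extra 4y J_{n+1} in the one for K. Hence K_n/J_n - K_{n+1}/J_{n+1} =
    y / ((n+1)^2 + y^2), and the sum is 2 K_0/J_0. *)
Lemma is_series_coth (y : R) : 0 < y ->
  is_series (fun m => 2 * y / (INR (S m) ^ 2 + y ^ 2))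
    (PI * (cosh (PI * y) / sinh (PI * y)) - 1 / y).
Proof.
intros Hy; assert (HPI := PI_RGT_0).
set (c := fun t => cosh (2 * y * t)); set (s := fun t => sinh (2 * y * t)).
assert (Dc : forall t, is_derive c t (2 * y * s t)) by (intros t; apply is_derive_cosh_scal).
assert (Ds : forall t, is_derive s t (2 * y * c t)) by (intros t; apply is_derive_sinh_scal).
assert (Pc : forall t, 0 < c t) by (intros t; exact (cosh_pos (2 * y * t))).
assert (Ps : forall t, 0 <= t -> 0 <= s t).
  intros t Ht; apply (sinh_nonneg (2 * y * t)), Rmult_le_pos; lra.
assert (s0 : s 0 = 0) by (unfold s; rewrite Rmult_0_r; apply sinh_0).
assert (s1 : s (PI / 2) = sinh (PI * y)) by (unfold s; f_equal; field).
assert (c1 : c (PI / 2) = cosh (PI * y)) by (unfold c; f_equal; field).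
clearbody c s.
assert (Cc : forall t, continuous c t)
  by (intros t; apply (ex_derive_continuous c); eexists; apply Dc).
assert (Cs : forall t, continuous s t)
  by (intros t; apply (ex_derive_continuous s); eexists; apply Ds).
assert (Cts : forall t, continuous (fun t => t * s t) t).
  intros t; apply (continuous_mult (fun t => t) s); [apply continuous_id|apply Cs].
assert (Ccst : forall (k : R) (f : R -> R), (forall t, continuous f t) ->
                 forall t, continuous (fun t => k * f t) t).
  intros k f Hf t; apply (continuous_mult (fun _ => k) f); [apply continuous_const|apply Hf].
set (J := fun n => cos_moment n c); set (K := fun n => cos_moment n (fun t => t * s t)).
assert (HJ : forall n, 0 < J n).
  intros n; exact (cos_moment_pos n c Cc Pc).
(* Since c'' = (2y)^2 c, the coefficient 4(n+1)^2 is shifted to 4((n+1)^2 + y^2). *)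
assert (SJ : forall n, 4 * (INR (S n) ^ 2 + y ^ 2) * J (S n)
                       = 2 * INR (S n) * (2 * INR n + 1) * J n).
  intros n; unfold J.
  rewrite <- (cos_moment_parts n c (fun t => 2 * y * s t) (fun t => (2 * y) ^ 2 * c t)).
  - rewrite cos_moment_scal by exact Cc; ring.
  - exact Dc.
  - intros t; replace ((2 * y) ^ 2 * c t) with (2 * y * (2 * y * c t)) by ring.
    apply is_derive_scal, Ds.
  - now apply Ccst.
  - rewrite s0; ring.
(* Here (t s)'' = 4y c + (2y)^2 t s; the first summand yields the term in J. *)
assert (SK : forall n, 4 * (INR (S n) ^ 2 + y ^ 2) * K (S n) + 4 * y * J (S n)
                       = 2 * INR (S n) * (2 * INR n + 1) * K n).
  intros n; unfold J, K.
  rewrite <- (cos_moment_parts n (fun t => t * s t) (fun t => s t + t * (2 * y * c t))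
                (fun t => 4 * y * c t + (2 * y) ^ 2 * (t * s t))).
  - rewrite cos_moment_plus by now apply Ccst.
    rewrite !cos_moment_scal by assumption; ring.
  - intros t; replace (s t + t * (2 * y * c t)) with (1 * s t + t * (2 * y * c t)) by ring.
    apply (is_derive_mult (fun t => t) s); [apply @is_derive_id|apply Ds|apply Rmult_comm].
  - intros t.
    replace (4 * y * c t + (2 * y) ^ 2 * (t * s t))
      with (2 * y * c t + (1 * (2 * y * c t) + t * (2 * y * (2 * y * s t)))) by ring.
    apply @is_derive_plus; [apply Ds|].
    apply (is_derive_mult (fun t => t) (fun t => 2 * y * c t));
      [apply @is_derive_id|apply is_derive_scal, Dc|apply Rmult_comm].
  - intros t; apply @continuous_plus; now apply Ccst.
  - rewrite s0; ring.
(* The upper bound is [cos_moment_decay] with g = s and g' = 2y c. *)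
assert (BK : forall n, 0 <= K (S n) / J (S n) <= y / INR (S n)).
  intros n; assert (Hn : 0 < INR (S n)) by apply lt_0_INR, Nat.lt_0_succ.
  split.
    apply Rdiv_le_0_compat; [|apply HJ].
    refine (cos_moment_nonneg (S n) (fun t => t * s t) Cts _).
    intros t Ht; apply Rmult_le_pos; auto.
  assert (H := cos_moment_decay n s (fun t => 2 * y * c t) Ds (Ccst _ _ Cc)).
  rewrite cos_moment_scal in H by exact Cc.
  fold (J (S n)) (K (S n)) in H.
  apply (Rmult_le_reg_l (2 * INR (S n) * J (S n))).
    apply Rmult_lt_0_compat; [lra|apply HJ].
  specialize (HJ (S n)).
  replace (2 * INR (S n) * J (S n) * (K (S n) / J (S n))) with (2 * INR (S n) * K (S n))
    by (field; lra).
  replace (2 * INR (S n) * J (S n) * (y / INR (S n))) with (2 * y * J (S n))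
    by (field; lra).
  exact (H s0 Ps).
assert (HS : 0 < sinh (PI * y)).
  rewrite <- sinh_0; apply sinh_lt, Rmult_lt_0_compat; lra.
assert (J0 : J 0%nat = sinh (PI * y) / (2 * y)).
  unfold J; rewrite (cos_moment_0 c (fun t => / (2 * y) * s t)); [|..|exact Cc].
    rewrite s0, s1; field; lra.
  intros t; replace (c t) with (/ (2 * y) * (2 * y * c t)) by (field; lra).
  apply is_derive_scal, Ds.
assert (K0 : K 0%nat = PI * cosh (PI * y) / (4 * y) - sinh (PI * y) / (4 * y ^ 2)).
  unfold K; rewrite (cos_moment_0 _ (fun t => / (2 * y) * (t * c t) - / (4 * y ^ 2) * s t));
    [|..|exact Cts].
    rewrite s0, s1, c1; field; lra.
  intros t.
  replace (t * s t) with (/ (2 * y) * (1 * c t + t * (2 * y * s t)) - / (4 * y ^ 2) * (2 * y * c t))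
    by (field; lra).
  apply @is_derive_minus; [|apply is_derive_scal, Ds].
  apply is_derive_scal, (is_derive_mult (fun t => t) c);
    [apply @is_derive_id|apply Dc|apply Rmult_comm].
replace (PI * (cosh (PI * y) / sinh (PI * y)) - 1 / y) with (2 * (K 0%nat / J 0%nat))
  by (rewrite J0, K0; field; lra).
apply (is_series_telescope _ (fun n => 2 * (K n / J n))).
- intros n; specialize (SJ n); specialize (SK n).
  assert (P := HJ n); assert (P' := HJ (S n)).
  assert (Hn : 0 < INR (S n)) by apply lt_0_INR, Nat.lt_0_succ.
  assert (Hn0 := pos_INR n).
  assert (0 < INR (S n) ^ 2) by now apply pow_lt.
  assert (0 < y ^ 2) by now apply pow_lt.
  replace (K n / J n) with ((2 * INR (S n) * (2 * INR n + 1) * K n)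
    / (2 * INR (S n) * (2 * INR n + 1) * J n)) by (field; repeat split; lra).
  rewrite <- SJ, <- SK; field; repeat split; lra.
- apply is_lim_seq_incr_1.
  apply (is_lim_seq_le_le (fun _ => 0) _ (fun n => (2 * y) / INR (S n))).
  + intros n; specialize (BK n); unfold Rdiv in *; lra.
  + apply is_lim_seq_const.
  + apply is_lim_seq_div_INR_S.
Qed.

(** * Exchange of summation in nonnegative double series *)

Lemma sum_n_nonneg (u : nat -> R) (N : nat) : (forall n, 0 <= u n) -> 0 <= sum_n u N.
Proof.
intros Hu; induction N as [|N IH]; [rewrite sum_O; apply Hu|].
rewrite sum_Sn; unfold plus; simpl; generalize (Hu (S N)); lra.
Qed.

Lemma sum_n_le_Series (u : nat -> R) (N : nat) :
  (forall n, 0 <= u n) -> ex_series u -> sum_n u N <= Series u.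
Proof.
intros Hu Hex.
apply (is_lim_seq_incr_compare (sum_n u)).
- exact (Series_correct u Hex).
- intros n; rewrite sum_Sn; unfold plus; simpl; generalize (Hu (S n)); lra.
Qed.

Lemma Series_le_bound (u : nat -> R) (B : R) :
  (forall n, 0 <= u n) -> (forall N, sum_n u N <= B) -> ex_series u /\ Series u <= B.
Proof.
intros Hu HB.
assert (Hex : ex_finite_lim_seq (sum_n u)).
  apply (ex_finite_lim_seq_incr _ B); [|exact HB].
  intros n; rewrite sum_Sn; unfold plus; simpl; generalize (Hu (S n)); lra.
destruct Hex as [l Hl].
assert (Hs : is_series u l) by exact Hl.
split; [now exists l|].
rewrite (is_series_unique _ _ Hs).
apply (is_lim_seq_le (sum_n u) (fun _ => B) l B HB Hl (is_lim_seq_const B)).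
Qed.

Lemma ex_series_le_nonneg (u v : nat -> R) :
  (forall n, 0 <= u n <= v n) -> ex_series v -> ex_series u.
Proof.
intros H; apply (ex_series_le (V := R_CompleteNormedModule)).
intros n; unfold norm; simpl; unfold abs; simpl.
rewrite Rabs_pos_eq; apply H.
Qed.

Lemma Series_nonneg (u : nat -> R) :
  (forall n, 0 <= u n) -> ex_series u -> 0 <= Series u.
Proof.
intros Hu Hex; eapply Rle_trans; [|apply (sum_n_le_Series u 0 Hu Hex)].
rewrite sum_O; apply Hu.
Qed.

(** Each entry is at most its row sum, so the columns converge. The sum of the first columns is the
    series over the rows of partial row sums, and these are bounded by the full row sums. *)
Lemma double_series_le (a : nat -> nat -> R) :
  (forall n m, 0 <= a n m) -> (forall n, ex_series (a n)) ->
  ex_series (fun n => Series (a n)) ->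
  (forall m, ex_series (fun n => a n m)) /\
  ex_series (fun m => Series (fun n => a n m)) /\
  Series (fun m => Series (fun n => a n m)) <= Series (fun n => Series (a n)).
Proof.
intros Ha Hrow Hex.
assert (Hcol : forall m, ex_series (fun n => a n m)).
  intros m; apply (ex_series_le_nonneg _ (fun n => Series (a n))); [|exact Hex].
  intros n; split; [apply Ha|].
  eapply Rle_trans; [|apply (sum_n_le_Series (a n) m (Ha n) (Hrow n))].
  destruct m as [|m]; [rewrite sum_O; lra|].
  rewrite sum_Sn; unfold plus; simpl.
  generalize (sum_n_nonneg (a n) m (Ha n)); lra.
split; [exact Hcol|].
apply Series_le_bound.
  intros m; apply Series_nonneg; auto.
intros M.
assert (Hsum : is_series (fun n => sum_n (a n) M) (sum_n (fun m => Series (fun n => a n m)) M)).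
  induction M as [|M IH].
    rewrite sum_O; apply (is_series_ext (fun n => a n 0%nat)).
      intros n; now rewrite sum_O.
    now apply Series_correct.
  rewrite sum_Sn; apply (is_series_ext (fun n => plus (sum_n (a n) M) (a n (S M)))).
    intros n; now rewrite sum_Sn.
  apply (is_series_plus (V := R_NormedModule)); [exact IH|now apply Series_correct].
rewrite <- (is_series_unique _ _ Hsum).
apply Series_le; [|exact Hex].
intros n; split.
- now apply sum_n_nonneg.
- apply sum_n_le_Series; auto.
Qed.

(** The inequality is applied to the array and then to its transpose, whose summability hypotheses
    are conclusions of the first application. *)
Lemma is_series_swap (a : nat -> nat -> R) :
  (forall n m, 0 <= a n m) -> (forall n, ex_series (a n)) ->
  ex_series (fun n => Series (a n)) ->
  (forall m, ex_series (fun n => a n m)) /\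
  is_series (fun m => Series (fun n => a n m)) (Series (fun n => Series (a n))).
Proof.
intros Ha Hrow Hex.
destruct (double_series_le a Ha Hrow Hex) as [Hcol [Hex' Hle]].
destruct (double_series_le (fun m n => a n m) (fun m n => Ha n m) Hcol Hex') as [_ [_ Hge]].
split; [exact Hcol|].
replace (Series (fun n => Series (a n))) with (Series (fun m => Series (fun n => a n m)))
  by (apply Rle_antisym; [exact Hle|exact Hge]).
now apply Series_correct.
Qed.

(** * The lattice sums T(a) and their reflection formula *)

Definition lattice_term (a : R) (n m : nat) : R :=
  1 / (INR (S n) ^ 2 * (INR (S m) ^ 2 + a ^ 2 * INR (S n) ^ 2)).

Definition lattice_sum (a : R) : R := Series (fun n => Series (lattice_term a n)).

(** Dropping a^2 n^2 from the denominator leaves a product whose double sum is zeta(2)^2; this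
    majorant gives all the convergence needed for T(a). *)
Lemma lattice_term_bounds (a : R) (n m : nat) :
  0 <= lattice_term a n m <= 1 / INR (S n) ^ 2 * (1 / INR (S m) ^ 2).
Proof.
assert (Hn : 0 < INR (S n) ^ 2) by (apply pow_lt, lt_0_INR; lia).
assert (Hm : 0 < INR (S m) ^ 2) by (apply pow_lt, lt_0_INR; lia).
assert (Ha : 0 <= a ^ 2 * INR (S n) ^ 2)
  by (apply Rmult_le_pos; [apply pow2_ge_0|lra]).
unfold lattice_term, Rdiv; rewrite !Rmult_1_l, Rinv_mult.
assert (0 < / INR (S n) ^ 2) by now apply Rinv_0_lt_compat.
assert (0 < / (INR (S m) ^ 2 + a ^ 2 * INR (S n) ^ 2)) by (apply Rinv_0_lt_compat; lra).
split; [apply Rmult_le_pos; lra|].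
apply Rmult_le_compat_l; [lra|].
apply Rinv_le_contravar; lra.
Qed.

Lemma is_series_scal_R (c : R) (u : nat -> R) (l : R) :
  is_series u l -> is_series (fun n => c * u n) (c * l).
Proof. exact (is_series_scal_l (V := R_NormedModule) c u l). Qed.

Lemma is_series_plus_R (u v : nat -> R) (l l' : R) :
  is_series u l -> is_series v l' -> is_series (fun n => u n + v n) (l + l').
Proof. exact (is_series_plus (V := R_NormedModule) u v l l'). Qed.

Lemma lattice_term_summable (a : R) :
  (forall n, ex_series (lattice_term a n)) /\
  ex_series (fun n => Series (lattice_term a n)).
Proof.
assert (Hz : forall n, is_series (fun m => 1 / INR (S n) ^ 2 * (1 / INR (S m) ^ 2))
                         (1 / INR (S n) ^ 2 * (PI ^ 2 / 6)))
  by (intros n; apply is_series_scal_R, is_series_zeta2).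
assert (Hrow : forall n, ex_series (lattice_term a n)).
  intros n; eapply ex_series_le_nonneg; [apply lattice_term_bounds|].
  eexists; apply Hz.
split; [exact Hrow|].
apply (ex_series_le_nonneg _ (fun n => PI ^ 2 / 6 * (1 / INR (S n) ^ 2))).
- intros n; split.
    apply Series_nonneg; [intros m; apply lattice_term_bounds|apply Hrow].
  rewrite Rmult_comm, <- (is_series_unique _ _ (Hz n)).
  apply Series_le; [intros m; apply lattice_term_bounds|eexists; apply Hz].
- eexists; apply is_series_scal_R, is_series_zeta2.
Qed.

(* After exchanging the order of summation in [lattice_sum (/ a)], the two
   summands add up to [1 / (n^2 m^2)]. *)
Lemma lattice_sum_reciprocal (a : R) : 0 < a ->
  lattice_sum a + lattice_sum (/ a) = (PI ^ 2 / 6) ^ 2.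
Proof.
intros Ha.
destruct (lattice_term_summable a) as [Hrow Hex].
destruct (lattice_term_summable (/ a)) as [Hrow' Hex'].
destruct (is_series_swap (lattice_term (/ a))) as [Hcol Hswap];
  [intros n m; apply lattice_term_bounds|exact Hrow'|exact Hex'|].
assert (H1 := is_series_plus_R _ _ _ _ (Series_correct _ Hex) Hswap).
assert (H2 := is_series_scal_R (PI ^ 2 / 6) _ _ is_series_zeta2).
unfold lattice_sum; rewrite <- (is_series_unique _ _ H1).
replace ((PI ^ 2 / 6) ^ 2) with (PI ^ 2 / 6 * (PI ^ 2 / 6)) by ring.
rewrite <- (is_series_unique _ _ H2).
apply Series_ext; intros n.
rewrite <- Series_plus by auto.
assert (H3 := is_series_scal_R (1 / INR (S n) ^ 2) _ _ is_series_zeta2).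
rewrite (Rmult_comm (PI ^ 2 / 6)), <- (is_series_unique _ _ H3).
(* Writing n, m for the shifted indices, the exchanged term is a^2 / (m^2 (m^2 + a^2 n^2)), so over
   the common denominator the numerators add up to m^2 + a^2 n^2. *)
apply Series_ext; intros m; unfold lattice_term.
assert (Hn : 0 < INR (S n)) by (apply lt_0_INR; lia).
assert (Hm : 0 < INR (S m)) by (apply lt_0_INR; lia).
assert (0 < INR (S m) ^ 2) by now apply pow_lt.
assert (0 < (a * INR (S n)) ^ 2) by (apply pow_lt, Rmult_lt_0_compat; lra).
field; repeat split; nra.
Qed.

(** * From lattice sums to [S3] and the final identity *)

Lemma coth_exp (x : R) : 0 < x -> cosh x / sinh x = 1 + 2 / (exp (2 * x) - 1).
Proof.
intros Hx.
assert (H1 : 1 < exp x) by (rewrite <- exp_0; now apply exp_increasing).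
unfold cosh, sinh; rewrite exp_Ropp.
replace (2 * x) with (x + x) by ring; rewrite exp_plus.
field; nra.
Qed.

(** Writing n for the shifted index, the row is the coth expansion at y = a n divided by 2 a n^3.
    The 1 in coth = 1 + 2/(e^(2y pi) - 1) gives the cubic term, and the -1/y gives the quartic
    one. *)
Lemma Series_lattice_term (a : R) (n : nat) : 0 < a ->
  a / PI * Series (lattice_term a n)
  = 1 / (INR (S n) ^ 3 * (exp (2 * PI * a * INR (S n)) - 1))
    + (/ 2 * (1 / INR (S n) ^ 3) - / (2 * PI * a) * (1 / INR (S n) ^ 4)).
Proof.
intros Ha; assert (HPI := PI_RGT_0).
assert (Hn : 0 < INR (S n)) by (apply lt_0_INR; lia).
assert (Hy : 0 < a * INR (S n)) by now apply Rmult_lt_0_compat.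
assert (Hx : 0 < PI * (a * INR (S n))) by now apply Rmult_lt_0_compat.
assert (H := is_series_scal_R (/ (2 * a * INR (S n) ^ 3)) _ _ (is_series_coth _ Hy)).
rewrite coth_exp in H by exact Hx.
replace (2 * (PI * (a * INR (S n)))) with (2 * PI * a * INR (S n)) in H by ring.
assert (He : 1 < exp (2 * PI * a * INR (S n))).
  rewrite <- exp_0; apply exp_increasing; nra.
rewrite (Series_ext _ (fun m => / (2 * a * INR (S n) ^ 3) *
   (2 * (a * INR (S n)) / (INR (S m) ^ 2 + (a * INR (S n)) ^ 2)))).
- rewrite (is_series_unique _ _ H); field; repeat split; lra.
- intros m; unfold lattice_term.
  assert (0 < INR (S m) ^ 2) by (apply pow_lt, lt_0_INR; lia).
  assert (0 < (a * INR (S n)) ^ 2) by now apply pow_lt.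
  field; repeat split; nra.
Qed.

Definition zeta3 : R := Series (fun n => 1 / INR (S n) ^ 3).

Lemma is_series_zeta3 : is_series (fun n => 1 / INR (S n) ^ 3) zeta3.
Proof.
apply Series_correct, (ex_series_le_nonneg _ (fun n => 1 / INR (S n) ^ 2));
  [|eexists; apply is_series_zeta2].
intros n; unfold Rdiv; rewrite !Rmult_1_l.
assert (Hn : 1 <= INR (S n)) by (rewrite S_INR; generalize (pos_INR n); lra).
split; [apply Rlt_le, Rinv_0_lt_compat, pow_lt; lra|].
apply Rinv_le_contravar; [apply pow_lt; lra|].
apply Rle_pow; [exact Hn|lia].
Qed.

Lemma S3_lattice_sum (a : R) : 0 < a ->
  S3 (2 * PI * a) = a / PI * lattice_sum a - zeta3 / 2 + PI ^ 3 / (180 * a).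
Proof.
intros Ha; assert (HPI := PI_RGT_0).
destruct (lattice_term_summable a) as [_ Hex].
assert (H := is_series_plus_R _ _ _ _
  (is_series_scal_R (a / PI) _ _ (Series_correct _ Hex))
  (is_series_plus_R _ _ _ _
     (is_series_scal_R (- / 2) _ _ is_series_zeta3)
     (is_series_scal_R (/ (2 * PI * a)) _ _ is_series_zeta4))).
unfold S3, lattice_sum.
erewrite Series_ext.
(* The zeta(4) contribution is (pi^4/90) / (2 pi a) = pi^3 / (180 a). *)
- rewrite (is_series_unique _ _ H); field; lra.
- intros n; cbv beta; rewrite Series_lattice_term by exact Ha; ring.
Qed.

Theorem theorem8 :
  PI ^ 3 = 720 * S3 PI - 900 * S3 (2 * PI) + 180 * S3 (4 * PI).
Proof.
assert (HPI := PI_RGT_0).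
assert (H1 := S3_lattice_sum 1); assert (H2 := S3_lattice_sum 2).
assert (Hh := S3_lattice_sum (/ 2)).
replace (2 * PI * 1) with (2 * PI) in H1 by ring.
replace (2 * PI * 2) with (4 * PI) in H2 by ring.
replace (2 * PI * / 2) with PI in Hh by field.
rewrite H1, H2, Hh by lra.
assert (R1 := lattice_sum_reciprocal 1); assert (R2 := lattice_sum_reciprocal 2).
rewrite Rinv_1 in R1.
(* The point a = 1 is its own reciprocal, which determines T(1). T(1/2) and T(2) both occur with
   weight 360/pi, so only their known sum matters. The coefficient of [zeta3] is a multiple of 720 -
   900 + 180 = 0, and the powers of pi add up to (10 - 25/2 + 7/2) pi^3. *)
replace (lattice_sum 1) with ((PI ^ 2 / 6) ^ 2 / 2) by lra.
replace (lattice_sum (/ 2)) with ((PI ^ 2 / 6) ^ 2 - lattice_sum 2) by lra.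
field; lra.
Qed.
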